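(* Let $E=\{x_1,\dots,x_n\}\subset\mathbb{R}^2$ with $x_i\,\mathcal{I}\,x_j$ for all $i\neq j$. The Max-Sum-Neighbor $p$-dispersion problem in $E$ is solvable in polynomial time. For $p=2$ and $p=3$ it is solvable in $O(n)$ time using $O(1)$ additional memory space. For $p>3$ there is an algorithm (a dynamic programming algorithm) that solves it to optimality, returning both the optimal value and an optimal selection of $p$ points, in $O(pn^2)$ time and $O(pn)$ memory space.
   Context: For $y=(y^1,y^2),z=(z^1,z^2)\in\mathbb{R}^2$ write $y\prec z$ iff $y^1<z^1$ and $y^2>z^2$, and $y\,\mathcal{I}\,z$ iff $y\prec z$ or $z\prec y$ (so $E$ is a two-dimensional Pareto front). Fix $\alpha>0$, let $d$ be the Euclidean distance on $\mathbb{R}^2$. Since the first coordinates of points of $E$ are pairwise distinct, index $E$ so that $x_1^1<x_2^1<\dots<x_n^1$ (then $x_1\prec x_2\prec\dots\prec x_n$), and set $d_{ij}=d(x_i,x_j)^\alpha$. For an integer $2\le p\le n$, the Max-Sum-Neighbor $p$-dispersion problem is $\max_{1\le i_1<i_2<\dots<i_p\le n}\sum_{j=1}^{p-1}d_{i_j,i_{j+1}}$, i.e. select $p$ points of $E$ maximizing the sum of the dissimilarities between consecutive selected points. Complexities are in a model where arithmetic operations, comparisons and evaluation of $d(\cdot,\cdot)^\alpha$ take $O(1)$ time; ''additional memory space'' excludes the storage of the input. *)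

(* Defs.v *)
From Stdlib Require Import Reals List Sorted Lia Lra.
Import ListNotations.
Open Scope R_scope.

Definition point := (R * R)%type.

Definition prec (y z : point) : Prop := fst y < fst z /\ snd y > snd z.

Definition dist (y z : point) : R :=
  sqrt ((fst y - fst z) ^ 2 + (snd y - snd z) ^ 2).

(** The point set E, given as the list [x_1; ...; x_n] (0-based here). *)
Definition pt (E : list point) (i : nat) : point := nth i E (0, 0).

Definition dd (E : list point) (alpha : R) (i j : nat) : R :=
  Rpower (dist (pt E i) (pt E j)) alpha.

(** E is a two-dimensional Pareto front indexed in increasing first
    coordinate: x_0 ≺ x_1 ≺ ... ≺ x_{n-1}. *)
Definition pareto_sorted (E : list point) : Prop :=
  forall i j, (i < j)%nat -> (j < length E)%nat -> prec (pt E i) (pt E j).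

Fixpoint obj (E : list point) (alpha : R) (s : list nat) : R :=
  match s with
  | i :: ((j :: _) as t) => dd E alpha i j + obj E alpha t
  | _ => 0
  end.

Definition feasible (E : list point) (p : nat) (s : list nat) : Prop :=
  length s = p /\ StronglySorted lt s /\ Forall (fun i => (i < length E)%nat) s.

Definition optimal_selection (E : list point) (alpha : R) (p : nat)
  (s : list nat) : Prop :=
  feasible E p s /\
  forall t, feasible E p t -> obj E alpha t <= obj E alpha s.

(** * Machine model: a unit-cost real RAM with indirect addressing.
    Each instruction costs one time step; arithmetic, comparisons and
    evaluation of d(.,.)^alpha are single instructions.  The input E is
    read-only and accessed through the oracle instructions [RDist] /
    [RCoord1] / [RCoord2]; it is not part of the memory. *)

Inductive instr : Type :=
  | NConst (r : nat) (k : nat)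
  | NAdd (r a b : nat)
  | NSub (r a b : nat)                    (* N[r] := N[a] - N[b] (truncated) *)
  | NLoad (r a : nat)
  | NStore (a b : nat)
  | RConst (r : nat) (z : Z)
  | RAdd (r a b : nat)
  | RSub (r a b : nat)
  | RMul (r a b : nat)
  | RLoad (r a : nat)
  | RStore (a b : nat)
  | RDist (r a b : nat)
  | RCoord1 (r a : nat)
  | RCoord2 (r a : nat)
  | JNLt (a b l : nat)
  | JRLt (a b l : nat)
  | Jmp (l : nat)
  | Out (a : nat)
  | Halt.

Definition program := list instr.

Record state : Type := mkState {
  pc : nat;
  nreg : nat -> nat;
  rreg : nat -> R;
  out : list nat
}.

Definition updN (f : nat -> nat) (r v : nat) : nat -> nat :=
  fun x => if Nat.eqb x r then v else f x.
Definition updR (f : nat -> R) (r : nat) (v : R) : nat -> R :=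
  fun x => if Nat.eqb x r then v else f x.

Definition init (n p : nat) : state :=
  mkState 0 (updN (updN (fun _ => 0%nat) 0 n) 1 p) (fun _ => 0) [].

Definition halted (P : program) (s : state) : Prop :=
  nth_error P (pc s) = None \/ nth_error P (pc s) = Some Halt.

Definition accessed (i : instr) (s : state) : list nat :=
  let N := nreg s in
  match i with
  | NConst r _ => [r]
  | NAdd r a b | NSub r a b => [r; a; b]
  | NLoad r a => [r; a; N a]
  | NStore a b => [a; b; N a]
  | RConst r _ => [r]
  | RAdd r a b | RSub r a b | RMul r a b => [r; a; b]
  | RLoad r a => [r; a; N a]
  | RStore a b => [a; b; N a]
  | RDist r a b => [r; a; b]
  | RCoord1 r a | RCoord2 r a => [r; a]
  | JNLt a b _ | JRLt a b _ => [a; b]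
  | Jmp _ => []
  | Out a => [a]
  | Halt => []
  end.

Definition exec_instr (E : list point) (alpha : R) (i : instr) (s : state)
  : state :=
  let N := nreg s in
  let Rg := rreg s in
  let nx := S (pc s) in
  match i with
  | NConst r k => mkState nx (updN N r k) Rg (out s)
  | NAdd r a b => mkState nx (updN N r (N a + N b)) Rg (out s)
  | NSub r a b => mkState nx (updN N r (N a - N b)) Rg (out s)
  | NLoad r a => mkState nx (updN N r (N (N a))) Rg (out s)
  | NStore a b => mkState nx (updN N (N a) (N b)) Rg (out s)
  | RConst r z => mkState nx N (updR Rg r (IZR z)) (out s)
  | RAdd r a b => mkState nx N (updR Rg r (Rg a + Rg b)) (out s)
  | RSub r a b => mkState nx N (updR Rg r (Rg a - Rg b)) (out s)
  | RMul r a b => mkState nx N (updR Rg r (Rg a * Rg b)) (out s)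
  | RLoad r a => mkState nx N (updR Rg r (Rg (N a))) (out s)
  | RStore a b => mkState nx N (updR Rg (N a) (Rg b)) (out s)
  | RDist r a b => mkState nx N (updR Rg r (dd E alpha (N a) (N b))) (out s)
  | RCoord1 r a => mkState nx N (updR Rg r (fst (pt E (N a)))) (out s)
  | RCoord2 r a => mkState nx N (updR Rg r (snd (pt E (N a)))) (out s)
  | JNLt a b l =>
      mkState (if Nat.ltb (N a) (N b) then l else nx) N Rg (out s)
  | JRLt a b l =>
      mkState (if Rlt_dec (Rg a) (Rg b) then l else nx) N Rg (out s)
  | Jmp l => mkState l N Rg (out s)
  | Out a => mkState nx N Rg (out s ++ [N a])
  | Halt => s
  end.

(** [exec E alpha P k M s f]: starting from [s], the program [P] halts in
    state [f] after exactly [k] steps, and every register address accessed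
    during the run is < [M] (so at most [M] memory cells are used). *)
Inductive exec (E : list point) (alpha : R) (P : program)
  : nat -> nat -> state -> state -> Prop :=
  | exec_halt M s : halted P s -> exec E alpha P 0 M s s
  | exec_step M k s i f :
      nth_error P (pc s) = Some i -> i <> Halt ->
      Forall (fun a => (a < M)%nat) (accessed i s) ->
      exec E alpha P k M (exec_instr E alpha i s) f ->
      exec E alpha P (S k) M s f.

Definition solves_within (E : list point) (alpha : R) (P : program)
  (p T M : nat) : Prop :=
  exists k f,
    exec E alpha P k M (init (length E) p) f /\ (k <= T)%nat /\
    optimal_selection E alpha p (out f) /\
    rreg f 0 = obj E alpha (out f).

(* Main.v *)
(* On a Pareto front sorted by first coordinate, both coordinate gaps between x_i and x_j
   grow when i decreases or j increases, so d_ij^alpha is monotone in that sense and an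
   optimal selection may always start at x_0 and end at x_(n-1) (points are indexed from 0).
   For p = 2 this settles the problem; for p = 3 only the middle point is free and one scan
   finds it in constant memory.  In general the best value V(k, i) of a chain of k points
   starting at x_i satisfies V(1, i) = 0 and V(k, i) = max_{j > i} (d_ij + V(k - 1, j)), and
   the optimum is V(p, 0).  Filling this p x n table row by row, with argmax pointers from
   which an optimal chain is read back, takes O(p n^2) steps. *)

Require Import Defs.
From Stdlib Require Import Reals List Sorted Lia Lra.
Import ListNotations.
Open Scope R_scope.

(** * Monotonicity along the front *)

Definition weak_prec (y z : point) : Prop := fst y <= fst z /\ snd y >= snd z.

Lemma dist_nested (a b c d : point) :
  weak_prec a b -> prec b c -> weak_prec c d ->
  0 < Defs.dist b c <= Defs.dist a d.
Proof.
  unfold weak_prec, prec, Defs.dist; intros [ab1 ab2] [bc1 bc2] [cd1 cd2]; split.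
  - apply sqrt_lt_R0; nra.
  - apply sqrt_le_1_alt; nra.
Qed.

Lemma pareto_sorted_weak_prec (E : list point) (i j : nat) :
  pareto_sorted E -> (i <= j)%nat -> (j < length E)%nat ->
  weak_prec (pt E i) (pt E j).
Proof.
  intros HE Hij Hj; destruct (Nat.eq_dec i j) as [->|Hne].
  - split; lra.
  - destruct (HE i j ltac:(lia) Hj); split; lra.
Qed.

Lemma dd_nested (E : list point) (alpha : R) (i i' j' j : nat) :
  0 <= alpha -> pareto_sorted E ->
  (i <= i')%nat -> (i' < j')%nat -> (j' <= j)%nat -> (j < length E)%nat ->
  dd E alpha i' j' <= dd E alpha i j.
Proof.
  intros Ha HE Hi Hij Hj HjE; apply Rle_Rpower_l; [exact Ha|].
  apply dist_nested; [apply pareto_sorted_weak_prec | apply HE | apply pareto_sorted_weak_prec];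
    solve [assumption | lia].
Qed.

Lemma optimal_two (E : list point) (alpha : R) :
  0 <= alpha -> pareto_sorted E -> (2 <= length E)%nat ->
  optimal_selection E alpha 2 [0%nat; (length E - 1)%nat].
Proof.
  intros Ha HE Hn; split; [repeat split; repeat constructor; lia|].
  intros t (Hl & Hs & Hf).
  destruct t as [|a [|b [|c t]]]; try discriminate.
  inversion Hs as [|? ? _ Hab]; inversion Hab; inversion Hf as [|? ? _ Hb]; inversion Hb; subst.
  simpl; apply Rplus_le_compat_r, dd_nested; assumption || lia.
Qed.

Lemma optimal_three (E : list point) (alpha : R) (a : nat) :
  0 <= alpha -> pareto_sorted E -> (1 <= a < length E - 1)%nat ->
  (forall b, (1 <= b < length E - 1)%nat ->
     dd E alpha 0 b + dd E alpha b (length E - 1) <=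
     dd E alpha 0 a + dd E alpha a (length E - 1)) ->
  optimal_selection E alpha 3 [0%nat; a; (length E - 1)%nat].
Proof.
  intros Ha HE Hav Hb; split; [repeat split; repeat constructor; lia|].
  intros t (Hl & Hs & Hf).
  destruct t as [|x [|y [|z [|w t]]]]; try discriminate.
  inversion Hs as [|? ? Hyz Hxyz]; inversion Hxyz as [|? ? Hxy Hxz]; inversion Hxz;
    inversion Hyz as [|? ? _ Hyz']; inversion Hyz';
    inversion Hf as [|? ? _ Hf']; inversion Hf' as [|? ? _ Hf'']; inversion Hf''; subst.
  specialize (Hb y ltac:(lia)).
  pose proof (dd_nested E alpha 0 x y y Ha HE ltac:(lia) Hxy (le_n y) ltac:(lia)).
  pose proof (dd_nested E alpha y y z (length E - 1) Ha HE (le_n y)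
    ltac:(lia) ltac:(lia) ltac:(lia)).
  simpl; lra.
Qed.

(** * Chains and the Bellman recursion *)

Definition chain_from (n k i : nat) (t : list nat) : Prop :=
  (exists r, t = i :: r) /\ length t = k /\ StronglySorted lt t /\
  Forall (fun a => (a < n)%nat) t.

Definition best_chain (E : list point) (alpha : R) (n k i : nat) (v : R)
  (q : list nat) : Prop :=
  chain_from n k i q /\ obj E alpha q = v /\
  forall t, chain_from n k i t -> obj E alpha t <= v.

Lemma obj_cons_cons (E : list point) (alpha : R) (i j : nat) (r : list nat) :
  obj E alpha (i :: j :: r) = dd E alpha i j + obj E alpha (j :: r).
Proof. reflexivity. Qed.

Lemma sorted_below_head_length (n i : nat) (r : list nat) :
  StronglySorted lt (i :: r) -> Forall (fun a => (a < n)%nat) (i :: r) ->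
  (i + length (i :: r) <= n)%nat.
Proof.
  revert i; induction r as [|j r IH]; intros i Hs Hf.
  - inversion Hf; simpl; lia.
  - inversion Hs as [|? ? Hs' Hlt]; inversion Hlt; inversion Hf; subst.
    specialize (IH j Hs' ltac:(assumption)); simpl in *; lia.
Qed.

Lemma chain_from_bound (n k i : nat) (t : list nat) :
  chain_from n k i t -> (i + k <= n)%nat.
Proof.
  intros ((r & ->) & <- & Hs & Hf); exact (sorted_below_head_length n i r Hs Hf).
Qed.

Lemma best_chain_below (E : list point) (alpha : R) (n k i : nat) (v : R) (q : list nat) :
  best_chain E alpha n k i v q -> Forall (fun a => (a < n)%nat) q.
Proof. now intros ((_ & _ & _ & Hq) & _). Qed.

Lemma best_chain_single (E : list point) (alpha : R) (n i : nat) :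
  (i < n)%nat -> best_chain E alpha n 1 i 0 [i].
Proof.
  intros Hi; split; [|split].
  - repeat split; eauto; repeat constructor; exact Hi.
  - reflexivity.
  - intros t ((r & ->) & Hl & _); destruct r; [simpl; lra | discriminate].
Qed.

Lemma best_chain_cons (E : list point) (alpha : R) (n K i a : nat) (v best : R)
  (q : list nat) (g : nat -> R) :
  (1 <= K)%nat -> (i < a)%nat -> best_chain E alpha n K a v q ->
  best = dd E alpha i a + v ->
  (forall j t, (i < j)%nat -> chain_from n K j t -> obj E alpha t <= g j) ->
  (forall j, (i < j)%nat -> (j + K <= n)%nat -> dd E alpha i j + g j <= best) ->
  best_chain E alpha n (S K) i best (i :: q).
Proof.
  intros HK Hia (((r & ->) & <- & Hs & Hf) & Hv & Hq) -> Hg Hbest; split; [|split].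
  - inversion Hf; subst; repeat split; eauto.
    + constructor; [exact Hs|].
      constructor; [exact Hia|].
      inversion Hs as [|? ? _ Hr]; eapply Forall_impl; [|exact Hr]; simpl; lia.
    + constructor; [lia | exact Hf].
  - rewrite obj_cons_cons; lra.
  - intros t ((r' & ->) & Hl & Hs' & Hf').
    destruct r' as [|j r']; [simpl in Hl; lia|].
    inversion Hs' as [|? ? Hsj Hlt]; inversion Hlt as [|? ? Hij _]; inversion Hf'; subst.
    assert (Hc : chain_from n (length (a :: r)) j (j :: r')).
    { repeat split; eauto. }
    specialize (Hg j _ Hij Hc); specialize (Hbest j Hij (chain_from_bound _ _ _ _ Hc)).
    rewrite obj_cons_cons; lra.
Qed.

Lemma best_chain_optimal (E : list point) (alpha : R) (p : nat) (v : R) (q : list nat) :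
  0 <= alpha -> pareto_sorted E -> (2 <= p)%nat ->
  best_chain E alpha (length E) p 0 v q ->
  optimal_selection E alpha p q /\ obj E alpha q = v.
Proof.
  intros Ha HE Hp (((r & ->) & Hl & Hs & Hf) & Hv & Hq).
  split; [|exact Hv]; split; [repeat split; assumption|].
  intros t (Hlt & Hst & Hft); rewrite Hv.
  destruct t as [|x [|y r']]; simpl in Hlt; try lia.
  inversion Hst as [|? ? Hsy Hlt']; inversion Hlt' as [|? ? Hxy _];
    inversion Hft as [|? ? Hx Hfy]; inversion Hfy as [|? ? Hy _]; subst.
  apply Rle_trans with (obj E alpha (0%nat :: y :: r')).
  - pose proof (dd_nested E alpha 0 x y y Ha HE ltac:(lia) Hxy (le_n y) Hy).
    rewrite !obj_cons_cons; lra.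
  - apply Hq; repeat split; eauto.
    + constructor; [exact Hsy|]; constructor; [lia|].
      inversion Hsy as [|? ? _ Hr]; eapply Forall_impl; [|exact Hr]; simpl; lia.
    + constructor; [lia | exact Hfy].
Qed.

(** * Runs of the RAM *)

Section Runs.

Variables (E : list point) (alpha : R) (P : program) (M : nat).

Inductive run : nat -> state -> state -> Prop :=
  | run_refl s : run 0 s s
  | run_step k s i f :
      nth_error P (pc s) = Some i -> i <> Halt ->
      Forall (fun a => (a < M)%nat) (accessed i s) ->
      run k (exec_instr E alpha i s) f -> run (S k) s f.

Lemma run_trans (k1 k2 : nat) (s s1 s2 : state) :
  run k1 s s1 -> run k2 s1 s2 -> run (k1 + k2) s s2.
Proof. induction 1; intros; simpl; [assumption | econstructor; eauto]. Qed.

Lemma exec_of_run (k : nat) (s f : state) :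
  run k s f -> halted P f -> exec E alpha P k M s f.
Proof. induction 1; intros; econstructor; eauto. Qed.

Definition reaches (T : nat) (s : state) (Q : state -> Prop) : Prop :=
  exists t f, run t s f /\ (t <= T)%nat /\ Q f.

Lemma reaches_seq (T1 T2 T : nat) (s : state) (Q Q' : state -> Prop) :
  (T1 + T2 <= T)%nat -> reaches T1 s Q -> (forall s', Q s' -> reaches T2 s' Q') ->
  reaches T s Q'.
Proof.
  intros HT (t1 & s1 & H1 & Ht1 & HQ) H2; destruct (H2 s1 HQ) as (t2 & f & H3 & Ht2 & HQ').
  exists (t1 + t2)%nat, f; split; [eapply run_trans; eassumption | split; [lia | exact HQ']].
Qed.

Lemma reaches_weaken (T T' : nat) (s : state) (Q Q' : state -> Prop) :
  (T <= T')%nat -> (forall f, Q f -> Q' f) -> reaches T s Q -> reaches T' s Q'.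
Proof. intros HT HQ (t & f & H & Ht & Hf); exists t, f; split; [exact H | split; [lia | auto]]. Qed.

End Runs.

Lemma run_widen (E : list point) (alpha : R) (P : program) (M M' k : nat) (s f : state) :
  (M <= M')%nat -> run E alpha P M k s f -> run E alpha P M' k s f.
Proof.
  intros HM; induction 1; econstructor; eauto.
  eapply Forall_impl; [|eassumption]; simpl; lia.
Qed.

Lemma solves_within_weaken (E : list point) (alpha : R) (P : program) (p T T' M : nat) :
  (T <= T')%nat -> solves_within E alpha P p T M -> solves_within E alpha P p T' M.
Proof.
  intros H (k & f & Hk & HkT & Hf); exists k, f; split; [exact Hk | split; [lia | exact Hf]].
Qed.

Lemma solves_within_of_reaches (E : list point) (alpha : R) (P : program) (p T M : nat) :
  reaches E alpha P M T (init (length E) p)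
    (fun f => halted P f /\ optimal_selection E alpha p (out f) /\
              rreg f 0 = obj E alpha (out f)) ->
  solves_within E alpha P p T M.
Proof.
  intros (t & f & Hrun & Ht & Hh & Hopt & Hv).
  exists t, f; split; [exact (exec_of_run E alpha P M t _ f Hrun Hh) | tauto].
Qed.

Lemma updN_eq (f : nat -> nat) (r v x : nat) : x = r -> updN f r v x = v.
Proof. intros ->; unfold updN; now rewrite Nat.eqb_refl. Qed.
Lemma updN_neq (f : nat -> nat) (r v x : nat) : x <> r -> updN f r v x = f x.
Proof. intros H; unfold updN; now rewrite (proj2 (Nat.eqb_neq x r) H). Qed.
Lemma updR_eq (f : nat -> R) (r : nat) (v : R) (x : nat) : x = r -> updR f r v x = v.
Proof. intros ->; unfold updR; now rewrite Nat.eqb_refl. Qed.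
Lemma updR_neq (f : nat -> R) (r : nat) (v : R) (x : nat) : x <> r -> updR f r v x = f x.
Proof. intros H; unfold updR; now rewrite (proj2 (Nat.eqb_neq x r) H). Qed.

(** * The dynamic program *)

Definition table_base : nat := 16.

(* Cell (k, i) of the table sits at address [cell n k i] of both register banks: the real
   cell holds V(k, i), the nat cell the second point of a best k-point chain from x_i.
   Registers below [table_base] are scratch. *)
Definition cell (n k i : nat) : nat := (table_base + k * n + i)%nat.

Lemma cell_ge_base (n k i : nat) : (table_base <= cell n k i)%nat.
Proof. unfold cell; lia. Qed.

Lemma cell_lt_row (n k K i : nat) : (k < K)%nat -> (i < n)%nat -> (cell n k i < cell n K 0)%nat.
Proof. unfold cell; intros; nia. Qed.

Lemma cell_lt_end (n p k i : nat) :
  (k <= p)%nat -> (i < n)%nat -> (cell n k i < cell n (S p) 0)%nat.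
Proof. intros; apply cell_lt_row; lia. Qed.

Lemma cell_add (n k j : nat) : (cell n k 0 + j)%nat = cell n k j.
Proof. unfold cell; lia. Qed.

Lemma cell_prev_row (n K : nat) : (1 <= K)%nat -> (cell n K 0 - n)%nat = cell n (K - 1) 0.
Proof.
  intros; unfold cell; destruct K as [|K]; [lia|].
  replace (S K - 1)%nat with K by lia; rewrite Nat.mul_succ_l; lia.
Qed.

Lemma cell_next_row (n K : nat) : cell n K n = cell n (S K) 0.
Proof. unfold cell; rewrite Nat.mul_succ_l; lia. Qed.

Fixpoint trace (nx : nat -> nat) (n k i : nat) : list nat :=
  match k with
  | 0 => []
  | S k' => i :: match k' with 0 => [] | S _ => trace nx n k' (nx (cell n k i)) end
  end.

Lemma trace_SS (nx : nat -> nat) (n k i : nat) :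
  trace nx n (S (S k)) i = i :: trace nx n (S k) (nx (cell n (S (S k)) i)).
Proof. reflexivity. Qed.

Lemma trace_ext_table (nr nr' : nat -> nat) (n k i : nat) :
  (forall x, (table_base <= x)%nat -> nr' x = nr x) -> trace nr' n k i = trace nr n k i.
Proof.
  intros H; revert i; induction k as [|[|k] IH]; intros i; simpl; [reflexivity ..|].
  rewrite H by apply cell_ge_base; f_equal; apply IH.
Qed.

Lemma trace_ext_rows (nr nr' : nat -> nat) (n k : nat) : forall i,
  Forall (fun a => (a < n)%nat) (trace nr n k i) ->
  (forall k' j, (2 <= k' <= k)%nat -> (j < n)%nat -> (k' = k -> j = i) ->
     nr' (cell n k' j) = nr (cell n k' j)) ->
  trace nr' n k i = trace nr n k i.
Proof.
  induction k as [|[|k] IH]; intros i Hf H; simpl; [reflexivity ..|].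
  simpl in Hf; inversion Hf as [|? ? Hi Hf']; subst.
  rewrite (H (S (S k)) i) by (reflexivity || lia); f_equal.
  apply IH; [exact Hf'|]; intros k' j Hk' Hj _; apply H; lia.
Qed.

Section Table.

Variables (E : list point) (alpha : R) (n : nat).

Definition table_filled (nr : nat -> nat) (rr : nat -> R) (K : nat) : Prop :=
  forall k i, (1 <= k < K)%nat -> (i + k <= n)%nat ->
    best_chain E alpha n k i (rr (cell n k i)) (trace nr n k i).

Definition row_filled (nr : nat -> nat) (rr : nat -> R) (K i : nat) : Prop :=
  forall i', (i' < i)%nat -> best_chain E alpha n K i' (rr (cell n K i')) (trace nr n K i').

Section Frame.

Variables (nr nr' : nat -> nat) (rr rr' : nat -> R).
Hypothesis (Hnr : forall x, (table_base <= x)%nat -> nr' x = nr x).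
Hypothesis (Hrr : forall x, (table_base <= x)%nat -> rr' x = rr x).

Lemma table_filled_ext (K : nat) : table_filled nr rr K -> table_filled nr' rr' K.
Proof.
  intros T k i Hk Hi; rewrite Hrr, (trace_ext_table nr nr') by (assumption || apply cell_ge_base).
  now apply T.
Qed.

Lemma row_filled_ext (K i : nat) : row_filled nr rr K i -> row_filled nr' rr' K i.
Proof.
  intros T i' Hi; rewrite Hrr, (trace_ext_table nr nr') by (assumption || apply cell_ge_base).
  now apply T.
Qed.

End Frame.

Variables (nr : nat -> nat) (rr : nat -> R).

Lemma table_filled_updN (K r v : nat) :
  (r < table_base)%nat -> table_filled nr rr K -> table_filled (updN nr r v) rr K.
Proof. intros Hr; apply table_filled_ext; intros; [apply updN_neq; lia | reflexivity]. Qed.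

Lemma table_filled_updR (K r : nat) (v : R) :
  (r < table_base)%nat -> table_filled nr rr K -> table_filled nr (updR rr r v) K.
Proof. intros Hr; apply table_filled_ext; intros; [reflexivity | apply updR_neq; lia]. Qed.

Lemma row_filled_updN (K i r v : nat) :
  (r < table_base)%nat -> row_filled nr rr K i -> row_filled (updN nr r v) rr K i.
Proof. intros Hr; apply row_filled_ext; intros; [apply updN_neq; lia | reflexivity]. Qed.

Lemma row_filled_updR (K i r : nat) (v : R) :
  (r < table_base)%nat -> row_filled nr rr K i -> row_filled nr (updR rr r v) K i.
Proof. intros Hr; apply row_filled_ext; intros; [reflexivity | apply updR_neq; lia]. Qed.

Lemma table_filled_2 : (forall i, (i < n)%nat -> rr (cell n 1 i) = 0) -> table_filled nr rr 2.
Proof.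
  intros H k i Hk Hi; replace k with 1%nat in * by lia.
  rewrite H by lia; apply best_chain_single; lia.
Qed.

Lemma row_filled_0 (K : nat) : row_filled nr rr K 0.
Proof. intros i' H; lia. Qed.

Lemma table_filled_S (K i : nat) :
  (n < i + K)%nat -> table_filled nr rr K -> row_filled nr rr K i -> table_filled nr rr (S K).
Proof.
  intros Hi T R k i0 Hk Hi0; destruct (Nat.eq_dec k K) as [->|Hne]; [apply R | apply T]; lia.
Qed.

Lemma table_filled_store (K i a : nat) (best : R) :
  table_filled nr rr K -> table_filled (updN nr (cell n K i) a) (updR rr (cell n K i) best) K.
Proof.
  intros T k i0 Hk Hi0; specialize (T k i0 Hk Hi0).
  pose proof (cell_lt_row n k K i0 ltac:(lia) ltac:(lia)).
  rewrite updR_neq by (unfold cell in *; lia).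
  rewrite (trace_ext_rows nr); [exact T | eapply best_chain_below; eassumption |].
  intros k' j Hk' Hj _; apply updN_neq.
  pose proof (cell_lt_row n k' K j ltac:(lia) Hj); unfold cell in *; lia.
Qed.

Lemma row_filled_store (K i a : nat) (best : R) :
  (2 <= K)%nat -> (i + K <= n)%nat -> (i < a)%nat -> (a + (K - 1) <= n)%nat ->
  table_filled nr rr K -> row_filled nr rr K i ->
  best = dd E alpha i a + rr (cell n (K - 1) a) ->
  (forall j, (i < j)%nat -> (j + (K - 1) <= n)%nat ->
     dd E alpha i j + rr (cell n (K - 1) j) <= best) ->
  row_filled (updN nr (cell n K i) a) (updR rr (cell n K i) best) K (S i).
Proof.
  intros HK Hi Hia Ha T R Hb Hbest i' Hi'.
  destruct (Nat.eq_dec i' i) as [->|Hne].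
  - rewrite updR_eq by reflexivity.
    destruct K as [|[|K]]; try lia.
    rewrite trace_SS, updN_eq by reflexivity.
    replace (S (S K) - 1)%nat with (S K) in * by lia.
    assert (Ta := T (S K) a ltac:(lia) ltac:(lia)).
    rewrite (trace_ext_rows nr).
    + apply best_chain_cons with (g := fun j => rr (cell n (S K) j)) (a := a)
        (v := rr (cell n (S K) a)); [lia | exact Hia | exact Ta | exact Hb | |].
      * intros j t Hj Ht; pose proof (chain_from_bound _ _ _ _ Ht).
        destruct (T (S K) j ltac:(lia) ltac:(lia)) as (_ & _ & Ho); apply Ho, Ht.
      * intros j Hj Hjn; apply Hbest; lia.
    + eapply best_chain_below; eassumption.
    + intros k' j Hk' Hj _; apply updN_neq.
      pose proof (cell_lt_row n k' (S (S K)) j ltac:(lia) Hj); unfold cell in *; lia.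
  - specialize (R i' ltac:(lia)).
    rewrite updR_neq by (unfold cell; lia).
    rewrite (trace_ext_rows nr); [exact R | eapply best_chain_below; eassumption |].
    intros k' j Hk' Hj Hjk; apply updN_neq.
    destruct (Nat.eq_dec k' K) as [->|Hk2].
    + rewrite (Hjk eq_refl); unfold cell; lia.
    + pose proof (cell_lt_row n k' K j ltac:(lia) Hj); unfold cell in *; lia.
Qed.

End Table.

Ltac cell_lia := first [ lia
  (* cell addresses, abstracted as numbers >= table_base, differ from scratch registers *)
  | repeat match goal with |- context [cell ?n ?k ?j] =>
      let H := fresh in assert (H := cell_ge_base n k j); revert H; generalize (cell n k j) end;
    intros; unfold table_base in *; lia
  | unfold cell, table_base; lia | unfold cell, table_base; nia ].

Ltac simpl_upd := repeat match goal with
  | |- context [updN ?f ?r ?v ?x] =>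
      first [rewrite (updN_eq f r v x) by cell_lia | rewrite (updN_neq f r v x) by cell_lia]
  | |- context [updR ?f ?r ?v ?x] =>
      first [rewrite (updR_eq f r v x) by cell_lia | rewrite (updR_neq f r v x) by cell_lia]
  | |- context [(cell ?n ?k 0 + ?j)%nat] => rewrite (cell_add n k j)
  end.

Ltac rewrite_regs :=
  repeat match goal with H : ?f ?c = _ |- context [?f ?c] => is_var f; rewrite H end.

Ltac regs := repeat progress (simpl_upd; rewrite_regs).

Ltac step := eapply run_step;
  [ reflexivity | discriminate
  | cbn [accessed nreg]; repeat apply Forall_cons; try apply Forall_nil; cbv beta; regs;
    first [unfold cell, table_base; lia | apply cell_lt_end; lia]
  | cbn [exec_instr pc nreg rreg out]].

Ltac splits := repeat match goal with |- _ /\ _ => split end.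

Ltac frame := repeat first
  [ apply table_filled_updN; [unfold table_base; lia|]
  | apply table_filled_updR; [unfold table_base; lia|]
  | apply row_filled_updN; [unfold table_base; lia|]
  | apply row_filled_updR; [unfold table_base; lia|] ];
  assumption.

(* Registers of [PD]: N[0] = n and N[1] = p; constants N[8] = 1, N[13] = 0 and R[5] = 0
   (there is no move instruction, so copies add a zero); N[2] = K is the row being filled and
   N[3], N[4] the addresses of rows K and K - 1; N[5] = i and N[6] = j, with loop bounds
   N[7] = n - K + 1 and N[12] = n - K + 2; R[1] and N[10] hold the best d_ij + V(K - 1, j)
   so far and its j.  From pc 40 on, the chain is output by following the pointers, N[11]
   being the current point and N[2] the number of points left. *)
Definition PD : program :=
 [ (*0*) NConst 8 1; NConst 2 2; NConst 3 16; NAdd 3 3 0; NAdd 3 3 0;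
   (*5*) JNLt 1 2 40; NSub 4 3 0; NSub 7 0 2; NAdd 7 7 8; NAdd 12 7 8; NConst 5 0;
   (*11*) JNLt 5 7 13; Jmp 37;
   (*13*) NAdd 6 5 8; RDist 3 5 6; NAdd 9 4 6; RLoad 4 9; RAdd 1 3 4; NAdd 10 6 13; NAdd 6 6 8;
   (*20*) JNLt 6 12 22; Jmp 32;
   (*22*) RDist 3 5 6; NAdd 9 4 6; RLoad 4 9; RAdd 2 3 4; JRLt 1 2 28; Jmp 30;
   (*28*) RAdd 1 2 5; NAdd 10 6 13;
   (*30*) NAdd 6 6 8; Jmp 20;
   (*32*) NAdd 9 3 5; RStore 9 1; NStore 9 10; NAdd 5 5 8; Jmp 11;
   (*37*) NAdd 2 2 8; NAdd 3 3 0; Jmp 5;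
   (*40*) NSub 3 3 0; NConst 11 0; RLoad 0 3; NAdd 2 1 13;
   (*44*) Out 11; JNLt 8 2 47; Halt;
   (*47*) NAdd 9 3 11; NLoad 11 9; NSub 2 2 8; NSub 3 3 0; Jmp 44 ].

Section PD_correct.

Variables (E : list point) (alpha : R) (n p : nat).

Definition dp_consts (s : state) : Prop :=
  nreg s 0 = n /\ nreg s 1 = p /\ nreg s 8 = 1%nat /\ nreg s 13 = 0%nat /\
  rreg s 5 = 0 /\ out s = [].

Definition dp_inner_inv (s : state) (K i j : nat) (best : R) (a : nat) : Prop :=
  dp_consts s /\ nreg s 2 = K /\ nreg s 3 = cell n K 0 /\ nreg s 4 = cell n (K - 1) 0 /\
  nreg s 5 = i /\ nreg s 6 = j /\ nreg s 7 = (n - K + 1)%nat /\ nreg s 12 = (n - K + 2)%nat /\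
  nreg s 10 = a /\ rreg s 1 = best /\
  (2 <= K <= p)%nat /\ (p <= n)%nat /\ (i + K <= n)%nat /\ (i < a < j)%nat /\
  (j <= n - K + 2)%nat /\
  best = dd E alpha i a + rreg s (cell n (K - 1) a) /\
  (forall j', (i < j' < j)%nat -> dd E alpha i j' + rreg s (cell n (K - 1) j') <= best) /\
  table_filled E alpha n (nreg s) (rreg s) K /\ row_filled E alpha n (nreg s) (rreg s) K i.

Lemma dp_inner_loop (m : nat) : forall s K i j best a,
  (n - K + 2 - j)%nat = m -> pc s = 20%nat -> dp_inner_inv s K i j best a ->
  reaches E alpha PD (cell n (S p) 0) (10 * m + 2) s
    (fun f => pc f = 32%nat /\ exists best' a', dp_inner_inv f K i (n - K + 2) best' a').
Proof.
  induction m as [|m IH]; intros [pc0 nr rr o] K i j best a Hm Hpc Hinv; cbn in Hpc; subst pc0;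
  destruct Hinv as ((H0 & H1 & H8 & H13 & H5r & Ho) & H2 & H3 & H4 & H5 & H6 & H7 & H12 & H10 &
    H1r &
     HK & Hpn & HiK & Ha & Hj & Hbest & Hall & HT & HR); cbn [nreg rreg out] in *.
  - do 2 eexists; split.
    { step. regs. destruct (Nat.ltb_spec j (n - K + 2)); [lia|].
      step. apply run_refl. }
    split; [lia|]; split; [reflexivity|]; exists best, a.
    replace j with (n - K + 2)%nat in * by lia.
    unfold dp_inner_inv, dp_consts; cbn [nreg rreg out]; splits; auto; lia.
  - apply reaches_seq with (T1 := 10%nat) (T2 := (10 * m + 2)%nat)
      (Q := fun s' => pc s' = 20%nat /\ exists best' a', dp_inner_inv s' K i (S j) best' a');
      [lia | | intros s' (Hpc' & best' & a' & Hinv'); apply (IH s' K i (S j) best' a'); auto; lia].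
    destruct (Rlt_dec best (dd E alpha i j + rr (cell n (K - 1) j))) as [Hlt|Hge].
    + do 2 eexists; split.
      { step. regs. destruct (Nat.ltb_spec j (n - K + 2)); [|lia].
        do 5 step. regs. destruct (Rlt_dec _ _) as [_|Hn']; [|contradiction].
        do 4 step. apply run_refl. }
      split; [lia|]; split; [reflexivity|].
      exists (dd E alpha i j + rr (cell n (K - 1) j) + 0), j.
      unfold dp_inner_inv, dp_consts; cbn [nreg rreg out];
        splits; regs; try frame; try lia; try lra.
      intros j' Hj'; regs; destruct (Nat.eq_dec j' j) as [->|Hne]; [lra|].
      specialize (Hall j' ltac:(lia)); lra.
    + do 2 eexists; split.
      { step. regs. destruct (Nat.ltb_spec j (n - K + 2)); [|lia].
        do 5 step. regs. destruct (Rlt_dec _ _) as [Hn'|_]; [contradiction|].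
        do 3 step. apply run_refl. }
      split; [lia|]; split; [reflexivity|]; exists best, a.
      unfold dp_inner_inv, dp_consts; cbn [nreg rreg out];
        splits; regs; try frame; try lia; try lra.
      intros j' Hj'; regs; destruct (Nat.eq_dec j' j) as [->|Hne]; [lra|].
      specialize (Hall j' ltac:(lia)); lra.
Qed.

Definition dp_row_inv (s : state) (K i : nat) : Prop :=
  dp_consts s /\ nreg s 2 = K /\ nreg s 3 = cell n K 0 /\ nreg s 4 = cell n (K - 1) 0 /\
  nreg s 5 = i /\ nreg s 7 = (n - K + 1)%nat /\ nreg s 12 = (n - K + 2)%nat /\
  (2 <= K <= p)%nat /\ (p <= n)%nat /\ (i <= n - K + 1)%nat /\
  table_filled E alpha n (nreg s) (rreg s) K /\ row_filled E alpha n (nreg s) (rreg s) K i.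

Lemma dp_store (s : state) (K i : nat) (best : R) (a : nat) :
  pc s = 32%nat -> dp_inner_inv s K i (n - K + 2) best a ->
  reaches E alpha PD (cell n (S p) 0) 5 s
    (fun f => pc f = 11%nat /\ dp_row_inv f K (S i)).
Proof.
  destruct s as [pc0 nr rr o]; intros Hpc Hinv; cbn in Hpc; subst pc0.
  destruct Hinv as ((H0 & H1 & H8 & H13 & H5r & Ho) & H2 & H3 & H4 & H5 & H6 & H7 & H12 & H10 &
    H1r &
    HK & Hpn & HiK & Ha & Hj & Hbest & Hall & HT & HR); cbn [nreg rreg out] in *.
  do 2 eexists; split.
  { do 5 step. apply run_refl. }
  split; [lia|]; split; [reflexivity|].
  set (nr9 := updN nr 9 (cell n K i)).
  assert (T9 : table_filled E alpha n nr9 rr K) by frame.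
  assert (R9 : row_filled E alpha n nr9 rr K i) by frame.
  pose proof (table_filled_store E alpha n nr9 rr K i a best T9).
  pose proof (row_filled_store E alpha n nr9 rr K i a best ltac:(lia) ltac:(lia) ltac:(lia)
    ltac:(lia) T9 R9 Hbest ltac:(intros j Hj1 Hj2; apply Hall; lia)).
  subst nr9.
  unfold dp_row_inv, dp_consts; cbn [nreg rreg out]; splits; regs; try lia; try frame; auto.
Qed.

Lemma dp_row_loop (m : nat) : forall s K i,
  (n - K + 1 - i)%nat = m -> pc s = 11%nat -> dp_row_inv s K i ->
  reaches E alpha PD (cell n (S p) 0) (m * (15 + 10 * n) + 2) s
    (fun f => pc f = 37%nat /\ dp_row_inv f K (n - K + 1)).
Proof.
  induction m as [|m IH]; intros [pc0 nr rr o] K i Hm Hpc Hinv; cbn in Hpc; subst pc0;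
  destruct Hinv as ((H0 & H1 & H8 & H13 & H5r & Ho) & H2 & H3 & H4 & H5 & H7 & H12 &
     HK & Hpn & Hi & HT & HR); cbn [nreg rreg out] in *.
  - do 2 eexists; split.
    { step. regs. destruct (Nat.ltb_spec i (n - K + 1)); [lia|].
      step. apply run_refl. }
    split; [lia|]; split; [reflexivity|].
    replace i with (n - K + 1)%nat in * by lia.
    unfold dp_row_inv, dp_consts; cbn [nreg rreg out]; splits; auto; lia.
  - apply reaches_seq with (T1 := 8%nat)
      (T2 := (10 * (n - K - i) + 2 + (5 + m * (15 + 10 * n)) + 2)%nat)
      (Q := fun s' => pc s' = 20%nat /\ exists best a, dp_inner_inv s' K i (i + 2) best a);
      [nia | |].
    { do 2 eexists; split.
      { step. regs. destruct (Nat.ltb_spec i (n - K + 1)); [|lia].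
        do 7 step. apply run_refl. }
      split; [lia|]; split; [reflexivity|].
      exists (dd E alpha i (i + 1) + rr (cell n (K - 1) (i + 1))), (i + 1)%nat.
      unfold dp_inner_inv, dp_consts; cbn [nreg rreg out];
        splits; regs; try frame; try lia; try lra.
      intros j' Hj'; replace j' with (i + 1)%nat by lia; regs; lra. }
    intros s' (Hpc' & best & a & Hinv').
    apply reaches_seq with (T1 := (10 * (n - K - i) + 2)%nat)
      (T2 := (5 + m * (15 + 10 * n) + 2)%nat)
      (Q := fun s' => pc s' = 32%nat /\ exists best a, dp_inner_inv s' K i (n - K + 2) best a);
      [lia | exact (dp_inner_loop (n - K - i) s' K i (i + 2) best a ltac:(lia) Hpc' Hinv') |].
    intros s2 (Hpc2 & best' & a' & Hinv2).
    apply reaches_seq with (T1 := 5%nat) (T2 := (m * (15 + 10 * n) + 2)%nat)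
      (Q := fun s' => pc s' = 11%nat /\ dp_row_inv s' K (S i));
      [lia | exact (dp_store s2 K i best' a' Hpc2 Hinv2) |].
    intros s3 (Hpc3 & Hinv3); apply (IH s3 K (S i)); auto; lia.
Qed.

Definition dp_outer_inv (s : state) (K : nat) : Prop :=
  dp_consts s /\ nreg s 2 = K /\ nreg s 3 = cell n K 0 /\
  (2 <= K <= S p)%nat /\ (2 <= p <= n)%nat /\ table_filled E alpha n (nreg s) (rreg s) K.

Lemma dp_outer_loop (m : nat) : forall s K,
  (S p - K)%nat = m -> pc s = 5%nat -> dp_outer_inv s K ->
  reaches E alpha PD (cell n (S p) 0) (m * (11 + n * (15 + 10 * n)) + 1) s
    (fun f => pc f = 40%nat /\ dp_outer_inv f (S p)).
Proof.
  induction m as [|m IH]; intros [pc0 nr rr o] K Hm Hpc Hinv; cbn in Hpc; subst pc0;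
  destruct Hinv as ((H0 & H1 & H8 & H13 & H5r & Ho) & H2 & H3 & HK & Hpn & HT);
    cbn [nreg rreg out] in *.
  - do 2 eexists; split.
    { step. regs. destruct (Nat.ltb_spec p K); [|lia].
      apply run_refl. }
    split; [lia|]; split; [reflexivity|].
    replace K with (S p) in * by lia.
    unfold dp_outer_inv, dp_consts; cbn [nreg rreg out]; splits; auto; lia.
  - apply reaches_seq with (T1 := 6%nat)
      (T2 := ((n - K + 1) * (15 + 10 * n) + 2 + (3 + m * (11 + n * (15 + 10 * n)) + 1))%nat)
      (Q := fun s' => pc s' = 11%nat /\ dp_row_inv s' K 0);
      [assert (n - K + 1 <= n)%nat by lia; nia | |].
    { do 2 eexists; split.
      { step. regs. destruct (Nat.ltb_spec p K); [lia|].
        do 5 step. apply run_refl. }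
      split; [lia|]; split; [reflexivity|].
      unfold dp_row_inv, dp_consts; cbn [nreg rreg out]; splits; regs; try frame; try lia; auto.
      - apply cell_prev_row; lia.
      - apply row_filled_0. }
    intros s' (Hpc' & Hinv').
    apply reaches_seq with (T1 := ((n - K + 1) * (15 + 10 * n) + 2)%nat)
      (T2 := (3 + m * (11 + n * (15 + 10 * n)) + 1)%nat)
      (Q := fun s' => pc s' = 37%nat /\ dp_row_inv s' K (n - K + 1));
      [lia | exact (dp_row_loop (n - K + 1) s' K 0 ltac:(lia) Hpc' Hinv') |].
    intros [pc1 nrf rrf of] (Hpc1 & Hf); cbn in Hpc1; subst pc1.
    destruct Hf as ((G0 & G1 & G8 & G13 & G5r & Go) & G2 & G3 & G4 & G5 & G7 & G12 &
      GK & Gpn & Gi & GT & GR); cbn [nreg rreg out] in *.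
    apply reaches_seq with (T1 := 3%nat) (T2 := (m * (11 + n * (15 + 10 * n)) + 1)%nat)
      (Q := fun s' => pc s' = 5%nat /\ dp_outer_inv s' (S K));
      [lia | | intros s2 (Hpc2 & Hinv2); apply (IH s2 (S K)); auto; lia].
    do 2 eexists; split.
    { do 3 step. apply run_refl. }
    split; [lia|]; split; [reflexivity|].
    assert (TN : table_filled E alpha n nrf rrf (S K))
      by (apply (table_filled_S _ _ _ _ _ _ (n - K + 1)); auto; lia).
    unfold dp_outer_inv, dp_consts; cbn [nreg rreg out]; splits; regs; try lia; try frame; auto.
    apply cell_next_row.
Qed.

Definition dp_trace_inv (nr0 : nat -> nat) (V : R) (s : state) (k cur : nat) (pre : list nat) :
  Prop :=
  nreg s 0 = n /\ nreg s 8 = 1%nat /\ nreg s 13 = 0%nat /\ nreg s 2 = k /\ nreg s 3 = cell n k 0 /\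
  nreg s 11 = cur /\ out s = pre /\ rreg s 0 = V /\ (1 <= k <= p)%nat /\
  (forall x, (table_base <= x)%nat -> nreg s x = nr0 x) /\
  pre ++ trace nr0 n k cur = trace nr0 n p 0 /\ Forall (fun a => (a < n)%nat) (trace nr0 n k cur).

Lemma dp_trace_loop (nr0 : nat -> nat) (V : R) (k : nat) : forall s cur pre,
  pc s = 44%nat -> dp_trace_inv nr0 V s k cur pre ->
  reaches E alpha PD (cell n (S p) 0) (8 * k) s
    (fun f => halted PD f /\ out f = trace nr0 n p 0 /\ rreg f 0 = V).
Proof.
  induction k as [|k IH]; intros [pc0 nr rr o] cur pre Hpc Hinv; cbn in Hpc; subst pc0;
  destruct Hinv as (H0 & H8 & H13 & H2 & H3 & H11 & Ho & H0r & Hk & Hfr & Htr & Hf);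
  cbn [nreg rreg out] in *; subst o; [lia|].
  assert (Hcur : (cur < n)%nat) by (simpl in Hf; inversion Hf; auto).
  destruct k as [|k].
  - do 2 eexists; split.
    { step. step. regs. destruct (Nat.ltb_spec 1 1); [lia|].
      apply run_refl. }
    split; [lia|]; split; [right; reflexivity|].
    cbn [out rreg]; regs; split; [rewrite <- Htr; reflexivity | auto].
  - apply reaches_seq with (T1 := 8%nat) (T2 := (8 * S k)%nat)
      (Q := fun s' => pc s' = 44%nat /\
         dp_trace_inv nr0 V s' (S k) (nr0 (cell n (S (S k)) cur)) (pre ++ [cur]));
      [lia | | intros s' (Hpc' & Hinv'); exact (IH s' _ _ Hpc' Hinv')].
    do 2 eexists; split.
    { step. step. regs. destruct (Nat.ltb_spec 1 (S (S k))); [|lia].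
      step. step. regs. rewrite (Hfr (cell n (S (S k)) cur)) by apply cell_ge_base.
      do 3 step. apply run_refl. }
    split; [lia|]; split; [reflexivity|].
    unfold dp_trace_inv; cbn [nreg rreg out]; splits; regs; try lia; auto.
    + rewrite cell_prev_row by lia; reflexivity.
    + intros x Hx; regs; auto.
    + rewrite <- app_assoc, <- Htr; reflexivity.
    + simpl in Hf; inversion Hf; auto.
Qed.

End PD_correct.

Lemma PD_run (E : list point) (alpha : R) (p : nat) : (2 <= p <= length E)%nat ->
  reaches E alpha PD (cell (length E) (S p) 0)
    (5 + ((S p - 2) * (11 + length E * (15 + 10 * length E)) + 1) + (4 + 8 * p))
    (init (length E) p)
    (fun f => halted PD f /\ best_chain E alpha (length E) p 0 (rreg f 0) (out f)).
Proof.
  intros Hp; set (n := length E) in *.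
  apply reaches_seq with (T1 := 5%nat)
    (T2 := ((S p - 2) * (11 + n * (15 + 10 * n)) + 1 + (4 + 8 * p))%nat)
    (Q := fun s => pc s = 5%nat /\ dp_outer_inv E alpha n p s 2); [lia | |].
  { do 2 eexists; split.
    { unfold init; do 5 step. apply run_refl. }
    split; [lia|]; split; [reflexivity|].
    unfold dp_outer_inv, dp_consts; cbn [nreg rreg out]; splits; regs; try reflexivity; try lia.
    - unfold cell, table_base; lia.
    - (* memory starts zeroed, and V(1, i) = 0 *)
      apply table_filled_2; reflexivity. }
  intros s1 (Hpc1 & Hi1).
  apply reaches_seq with (T1 := ((S p - 2) * (11 + n * (15 + 10 * n)) + 1)%nat)
    (T2 := (4 + 8 * p)%nat) (Q := fun f => pc f = 40%nat /\ dp_outer_inv E alpha n p f (S p));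
    [lia | exact (dp_outer_loop E alpha n p (S p - 2) s1 2 eq_refl Hpc1 Hi1) |].
  intros [pc2 nrf rrf o2] (Hpc2 & Hi2); cbn in Hpc2; subst pc2.
  destruct Hi2 as ((G0 & G1 & G8 & G13 & G5r & Go) & G2 & G3 & GK & Gpn & GT);
    cbn [nreg rreg out] in *.
  assert (Hopt := GT p 0%nat ltac:(lia) ltac:(lia)).
  apply reaches_seq with (T1 := 4%nat) (T2 := (8 * p)%nat)
    (Q := fun s => pc s = 44%nat /\ dp_trace_inv n p nrf (rrf (cell n p 0)) s p 0 []);
    [lia | |].
  { do 2 eexists; split.
    { do 4 step. apply run_refl. }
    split; [lia|]; split; [reflexivity|].
    assert (Hrp : (cell n (S p) 0 - n)%nat = cell n p 0)
      by (rewrite cell_prev_row by lia; f_equal; lia).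
    unfold dp_trace_inv; cbn [nreg rreg out]; splits; regs; rewrite ?Hrp; try reflexivity; try lia.
    - exact Go.
    - intros x Hx; regs; reflexivity.
    - eapply best_chain_below; eassumption. }
  intros s3 (Hpc3 & Hi3).
  eapply reaches_weaken;
    [reflexivity | | exact (dp_trace_loop E alpha n p nrf _ p s3 0 [] Hpc3 Hi3)].
  intros f (Hh & Hout & Hv); rewrite Hout, Hv; split; assumption.
Qed.

Lemma PD_time_bound (n p : nat) : (2 <= p <= n)%nat ->
  (5 + ((S p - 2) * (11 + n * (15 + 10 * n)) + 1) + (4 + 8 * p) <= 40 * p * n ^ 2)%nat.
Proof.
  intros Hp; rewrite Nat.pow_2_r.
  assert (S p - 2 <= p)%nat by lia.
  assert ((S p - 2) * (11 + n * (15 + 10 * n)) <= p * (11 + n * (15 + 10 * n)))%nat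
    by (apply Nat.mul_le_mono_r; lia).
  assert (4 <= n * n)%nat by nia.
  nia.
Qed.

Lemma PD_solves (E : list point) (alpha : R) (p : nat) :
  0 <= alpha -> pareto_sorted E -> (2 <= p <= length E)%nat ->
  solves_within E alpha PD p (40 * p * length E ^ 2) (40 * p * length E).
Proof.
  intros Ha HE Hp; apply solves_within_of_reaches.
  destruct (PD_run E alpha p Hp) as (t & f & Hrun & Ht & Hh & Hbest).
  destruct (best_chain_optimal E alpha p _ _ Ha HE ltac:(lia) Hbest) as [Hsel Hv].
  exists t, f; split; [|split; [|split; [exact Hh | split; [exact Hsel | symmetry; exact Hv]]]].
  - apply run_widen with (cell (length E) (S p) 0); [unfold cell, table_base; nia | exact Hrun].
  - pose proof (PD_time_bound (length E) p Hp); lia.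
Qed.

(** * Constant-memory programs for p = 2 and p = 3 *)

Definition P2 : program := [NConst 2 1; NSub 3 0 2; RDist 0 4 3; Out 4; Out 3; Halt].

Lemma P2_solves (E : list point) (alpha : R) :
  0 <= alpha -> pareto_sorted E -> (2 <= length E)%nat ->
  solves_within E alpha P2 2 (6 * length E + 6) 6.
Proof.
  intros Ha HE Hn; set (n := length E) in *.
  apply solves_within_of_reaches; do 2 eexists; split.
  { unfold init; do 5 step. apply run_refl. }
  split; [lia|]; split; [right; reflexivity|].
  cbn [out rreg]; regs; split; [exact (optimal_two E alpha Ha HE Hn) | simpl; ring].
Qed.

(* Registers of [P3]: N[2] = 1, N[3] = n - 1, N[4] = 0 and R[7] = 0; N[5] = k scans the
   middle candidates, and R[0], N[6] hold the best d_0k + d_k(n-1) so far and its k. *)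
Definition P3 : program :=
  [ (*0*) NConst 2 1; NSub 3 0 2; NConst 5 1; RDist 1 4 5; RDist 2 5 3; RAdd 0 1 2;
    (*6*) NConst 6 1; NAdd 5 5 2;
    (*8*) JNLt 5 3 10; Jmp 19;
    (*10*) RDist 1 4 5; RDist 2 5 3; RAdd 1 1 2; JRLt 0 1 15; Jmp 17;
    (*15*) RAdd 0 1 7; NAdd 6 5 4;
    (*17*) NAdd 5 5 2; Jmp 8;
    (*19*) Out 4; Out 6; Out 3; Halt ].

Definition p3_inv (E : list point) (alpha : R) (n : nat) (s : state) (k a : nat) : Prop :=
  nreg s 0 = n /\ nreg s 2 = 1%nat /\ nreg s 3 = (n - 1)%nat /\ nreg s 4 = 0%nat /\
  nreg s 5 = k /\ nreg s 6 = a /\ rreg s 7 = 0 /\ out s = [] /\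
  rreg s 0 = dd E alpha 0 a + dd E alpha a (n - 1) /\ (1 <= a < k)%nat /\ (k <= n - 1)%nat /\
  (forall b, (1 <= b < k)%nat -> dd E alpha 0 b + dd E alpha b (n - 1) <= rreg s 0).

Lemma p3_scan (E : list point) (alpha : R) (n m : nat) : forall s k a,
  (n - 1 - k)%nat = m -> pc s = 8%nat -> p3_inv E alpha n s k a ->
  reaches E alpha P3 20 (9 * m + 2) s
    (fun f => pc f = 19%nat /\ exists a', p3_inv E alpha n f (n - 1) a').
Proof.
  induction m as [|m IH]; intros [pc0 nr rr o] k a Hm Hpc Hinv; cbn in Hpc; subst pc0;
  destruct Hinv as (H0 & H2 & H3 & H4 & H5 & H6 & H7 & Ho & Hr0 & Ha & Hk & Hb);
  cbn [nreg rreg out] in *.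
  - do 2 eexists; split.
    { step. regs. destruct (Nat.ltb_spec k (n - 1)); [lia|].
      step. apply run_refl. }
    split; [lia|]; split; [reflexivity|]; exists a.
    replace k with (n - 1)%nat in * by lia.
    unfold p3_inv; cbn [nreg rreg out]; splits; auto; lia.
  - apply reaches_seq with (T1 := 9%nat) (T2 := (9 * m + 2)%nat)
      (Q := fun s' => pc s' = 8%nat /\ exists a', p3_inv E alpha n s' (S k) a');
      [lia | | intros s' (Hpc' & a' & Hinv'); apply (IH s' (S k) a'); auto; lia].
    rewrite Hr0 in Hb.
    destruct (Rlt_dec (dd E alpha 0 a + dd E alpha a (n - 1))
      (dd E alpha 0 k + dd E alpha k (n - 1))) as [Hlt|Hge].
    + do 2 eexists; split.
      { step. regs. destruct (Nat.ltb_spec k (n - 1)); [|lia].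
        do 4 step. regs. destruct (Rlt_dec _ _) as [_|Hn]; [|contradiction].
        do 4 step. apply run_refl. }
      split; [lia|]; split; [reflexivity|]; exists k.
      unfold p3_inv; cbn [nreg rreg out]; splits; regs; try lia; try lra; auto.
      intros b Hb'; regs; destruct (Nat.eq_dec b k) as [->|Hne]; [lra|].
      specialize (Hb b ltac:(lia)); lra.
    + do 2 eexists; split.
      { step. regs. destruct (Nat.ltb_spec k (n - 1)); [|lia].
        do 4 step. regs. destruct (Rlt_dec _ _) as [Hn|_]; [contradiction|].
        do 3 step. apply run_refl. }
      split; [lia|]; split; [reflexivity|]; exists a.
      unfold p3_inv; cbn [nreg rreg out]; splits; regs; try lia; try lra; auto.
      intros b Hb'; regs; destruct (Nat.eq_dec b k) as [->|Hne]; [lra|].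
      specialize (Hb b ltac:(lia)); lra.
Qed.

Lemma P3_solves (E : list point) (alpha : R) :
  0 <= alpha -> pareto_sorted E -> (3 <= length E)%nat ->
  solves_within E alpha P3 3 (20 * length E + 20) 20.
Proof.
  intros Ha HE Hn; set (n := length E) in *.
  apply solves_within_of_reaches.
  apply reaches_seq with (T1 := 8%nat) (T2 := (9 * (n - 1 - 2) + 2 + 3)%nat)
    (Q := fun s => pc s = 8%nat /\ p3_inv E alpha n s 2 1); [lia | |].
  { do 2 eexists; split.
    { unfold init; do 8 step. apply run_refl. }
    split; [lia|]; split; [reflexivity|].
    unfold p3_inv; cbn [nreg rreg out]; splits; regs; try lia; auto.
    intros b Hb; replace b with 1%nat by lia; regs; apply Rle_refl. }
  intros s (Hpc & Hinv).
  apply reaches_seq with (T1 := (9 * (n - 1 - 2) + 2)%nat) (T2 := 3%nat)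
    (Q := fun f => pc f = 19%nat /\ exists a, p3_inv E alpha n f (n - 1) a);
    [lia | exact (p3_scan E alpha n (n - 1 - 2) s 2 1 eq_refl Hpc Hinv) |].
  intros [pcf nr rr o] (Hpcf & a & Hf); cbn in Hpcf; subst pcf.
  destruct Hf as (H0 & H2 & H3 & H4 & H5 & H6 & H7 & Ho & Hr0 & Hak & Hk & Hb);
  cbn [nreg rreg out] in *.
  do 2 eexists; split.
  { do 3 step. apply run_refl. }
  split; [lia|]; split; [right; reflexivity|].
  cbn [out rreg]; regs; rewrite Ho; simpl app; split; [|simpl; lra].
  rewrite Hr0 in Hb; apply optimal_three; [assumption .. | lia | intros b Hb'; apply Hb; lia].
Qed.

Theorem theorem1 (alpha : R) (halpha : 0 < alpha) :
  (* polynomial time for every p *)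
  (exists (P : program) (c d : nat),
     forall (E : list point) (p : nat),
       pareto_sorted E -> (2 <= p <= length E)%nat ->
       exists M, solves_within E alpha P p (c * length E ^ d + c) M) /\
  (* p = 2 : O(n) time, O(1) additional memory *)
  (exists (P : program) (c : nat),
     forall (E : list point),
       pareto_sorted E -> (2 <= length E)%nat ->
       solves_within E alpha P 2 (c * length E + c) c) /\
  (* p = 3 : O(n) time, O(1) additional memory *)
  (exists (P : program) (c : nat),
     forall (E : list point),
       pareto_sorted E -> (3 <= length E)%nat ->
       solves_within E alpha P 3 (c * length E + c) c) /\
  (* p > 3 : O(p n^2) time, O(p n) memory *)
  (exists (P : program) (c : nat),
     forall (E : list point) (p : nat),
       pareto_sorted E -> (3 < p <= length E)%nat ->
       solves_within E alpha P p (c * p * length E ^ 2)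
                                 (c * p * length E)).
Proof.
  assert (Ha : 0 <= alpha) by lra.
  split; [|split; [|split]].
  - exists PD, 40%nat, 3%nat; intros E p HE Hp; exists (40 * p * length E)%nat.
    apply solves_within_weaken with (40 * p * length E ^ 2)%nat;
      [|exact (PD_solves E alpha p Ha HE Hp)].
    assert (p * length E ^ 2 <= length E ^ 3)%nat
      by (change (length E ^ 3)%nat with (length E * length E ^ 2)%nat;
          apply Nat.mul_le_mono_r; lia).
    nia.
  - exists P2, 6%nat; intros E HE Hn; exact (P2_solves E alpha Ha HE Hn).
  - exists P3, 20%nat; intros E HE Hn; exact (P3_solves E alpha Ha HE Hn).
  - exists PD, 40%nat; intros E p HE Hp; apply PD_solves; [exact Ha | exact HE | lia].
Qed.
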